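(* For positive integers $m,n$ let $\mathcal{I}(m,n)$ denote the probability that the map $x \mapsto \operatorname{ReLU}(Wx)$, $\mathbb{R}^n \to \mathbb{R}^m$, is injective, where $W \in \mathbb{R}^{m\times n}$ has iid standard normal entries. Let $c = m/n$ be held fixed as $n \to \infty$. Then $\mathcal{I}(m,n) \to 1$ if $c \geq 10.5$, and $\mathcal{I}(m,n) \to 0$ if $c \leq 3.3$.
   Context: $\operatorname{ReLU}(y)=\max(y,0)$ applied componentwise. *)

(* Defs.v *)
From HB Require Import structures.
From mathcomp Require Import all_boot all_order all_algebra.
From mathcomp Require Import all_classical all_reals all_analysis.
Set Implicit Arguments. Unset Strict Implicit. Unset Printing Implicit Defensive.
Import Order.TTheory GRing.Theory Num.Theory.
Local Open Scope classical_set_scope.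
Local Open Scope ring_scope.

Definition relu {R : realType} {m : nat} (v : 'cV[R]_m) : 'cV[R]_m :=
  \col_i Num.max (v i 0) 0.

Definition relu_injective {R : realType} {m n : nat} (W : 'M[R]_(m, n)) : Prop :=
  injective (fun x : 'cV[R]_n => relu (W *m x)).

Definition rand_mx {d} {T : measurableType d} {R : realType} {P : probability T R}
  {m n : nat} (W : 'I_m -> 'I_n -> {RV P >-> R}) (w : T) : 'M[R]_(m, n) :=
  \matrix_(i, j) W i j w.

(* The entries W i j are iid standard normal: each has law N(0,1), and the
   family is mutually independent (product rule for all Borel sets; choosing
   B i j = setT gives the product rule for every subfamily). *)
Definition iid_std_normal {d} {T : measurableType d} {R : realType}
  (P : probability T R) {m n : nat} (W : 'I_m -> 'I_n -> {RV P >-> R}) : Prop :=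
  (forall i j (A : set R), measurable A ->
      P (W i j @^-1` A) = normal_prob 0 1 A) /\
  (forall B : 'I_m -> 'I_n -> set R, (forall i j, measurable (B i j)) ->
      P [set w | forall i j, B i j (W i j w)] =
      (\prod_(i < m) \prod_(j < n) P (W i j @^-1` B i j))%E).

Definition inj_prob {d} {T : measurableType d} {R : realType} (P : probability T R)
  {m n : nat} (W : 'I_m -> 'I_n -> {RV P >-> R}) : \bar R :=
  P [set w | relu_injective (rand_mx W w)].

Arguments iid_std_normal {d T R} P {m n} W.
Arguments inj_prob {d T R} P {m n} W.

(* Main.v *)
Require Import Defs.
From HB Require Import structures.
From mathcomp Require Import all_boot all_order all_algebra.
From mathcomp Require Import ring lra zify.
From mathcomp Require Import all_classical all_reals all_analysis.
From mathcomp Require Import measurable_realfun.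
Set Implicit Arguments. Unset Strict Implicit. Unset Printing Implicit Defensive.
Import Order.TTheory GRing.Theory Num.Theory.
Import numFieldNormedType.Exports.
Local Open Scope classical_set_scope.
Local Open Scope ring_scope.

(** Call [W] generic if any [n] of its rows are linearly independent, which holds
    almost surely.  A generic [W] fails to give an injective ReLU layer exactly when
    some [y] makes all the entries of [W y] nonzero and fewer than [n] of them
    positive: if [relu (W x) = relu (W x')] with [x <> x'], then [x + x'] is strictly
    negative on the rows that do not annihilate [x - x'], and at most [n - 1] rows
    annihilate it.

    The law of [W] is invariant under changing the signs of rows, so the probability
    of an event is at most the largest proportion, over a fixed (generic) [W], of sign
    vectors [e] for which [e W] belongs to the event.  What remains is counting.

    For [c >= 10.5]: deletion-restriction bounds the number of sign patterns of
    [W y] by [(1 + x)^m x^-n], and the number of sign vectors agreeing with a given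
    pattern in fewer than [n] places has the same bound; at [x = 1/10] the product
    of the two is [o(2^m)].

    For [c <= 3.3]: all but an exponentially small proportion of the sign patterns of
    half of the rows is realized (Wendel), so [y] can be chosen negative on that half;
    on the other half, of size at most [1.65 n], fewer than [n] entries are positive
    for all but an exponentially small proportion of the signs. *)

(** * Counting sign vectors *)

(** Lists let an induction on the number of rows peel off the sign of one row. *)
Fixpoint signs (k : nat) : seq (seq bool) :=
  if k is k'.+1 then map (cons true) (signs k') ++ map (cons false) (signs k')
  else [:: [::]].

Definition cnt (k : nat) (p : seq bool -> Prop) : nat :=
  (\sum_(e <- signs k) `[< p e >])%N.

Lemma size_signs k : size (signs k) = (2 ^ k)%N.
Proof.
by elim: k => //= k IH; rewrite size_cat !size_map IH expnS mul2n addnn.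
Qed.

Lemma mem_signs k e : (e \in signs k) = (size e == k).
Proof.
elim: k e => [|k IH] [|b e] //=.
  by rewrite mem_cat; apply/negP => /orP[] /mapP[].
rewrite mem_cat eqSS -IH; apply/orP/idP => [[] /mapP[f fk [_ ->]]//|ek].
by case: b; [left|right]; apply/mapP; exists e.
Qed.

Lemma asbool_notF (P : Prop) : P -> `[< ~ P >] = false.
Proof. by move=> p; rewrite asboolF. Qed.

Lemma cnt0 p : cnt 0 p = `[< p [::] >].
Proof. by rewrite /cnt /= big_seq1. Qed.

Lemma cntS k p :
  cnt k.+1 p = (cnt k (fun e => p (true :: e)) + cnt k (fun e => p (false :: e)))%N.
Proof. by rewrite /cnt /= big_cat /= !big_map. Qed.

Lemma leq_cnt k (p q : seq bool -> Prop) :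
  (forall e, size e = k -> p e -> q e) -> (cnt k p <= cnt k q)%N.
Proof.
move=> pq; rewrite /cnt [X in (X <= _)%N]big_seq [X in (_ <= X)%N]big_seq.
apply: leq_sum => e; rewrite mem_signs => /eqP ek.
by case: asboolP => // /(pq _ ek) ?; rewrite asboolT.
Qed.

Lemma cnt_le_exp k p : (cnt k p <= 2 ^ k)%N.
Proof.
rewrite -size_signs -sum1_size /cnt; apply: leq_sum => e _; exact: leq_b1.
Qed.

(** One step of every Pascal-type recursion below: for each tail, the number of admissible heads is
    compared with two conditions on that tail. *)
Lemma cntS_le k (p q r : seq bool -> Prop) :
  (forall e, size e = k ->
    (`[< p (true :: e) >] + `[< p (false :: e) >] <= `[< q e >] + `[< r e >])%N) ->
  (cnt k.+1 p <= cnt k q + cnt k r)%N.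
Proof.
move=> H; rewrite cntS /cnt -!big_split /=.
rewrite [X in (X <= _)%N]big_seq [X in (_ <= X)%N]big_seq.
by apply: leq_sum => e; rewrite mem_signs => /eqP; exact: H.
Qed.

(** Union bound over the witnesses [t], by exchanging the two sums. *)
Lemma cnt_exists_le k (q r : seq bool -> Prop) (s : seq bool -> seq bool -> Prop) (K : nat) :
  (forall e, size e = k -> q e -> exists2 t, size t = k & r t /\ s t e) ->
  (forall t, size t = k -> (cnt k (s t) <= K)%N) ->
  (cnt k q <= cnt k r * K)%N.
Proof.
move=> qrs sK; apply: (@leq_trans (\sum_(t <- signs k) `[< r t >] * cnt k (s t))%N).
  have -> : (\sum_(t <- signs k) `[< r t >] * cnt k (s t) =
      \sum_(t <- signs k) \sum_(e <- signs k) `[< r t >] * `[< s t e >])%N.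
    by apply: eq_bigr => t _; rewrite /cnt big_distrr.
  rewrite /cnt exchange_big /= big_seq [X in (_ <= X)%N]big_seq; apply: leq_sum => e.
  rewrite mem_signs => /eqP ek; case: asboolP => // /(qrs _ ek)[t tk [rt st]].
  have tin : t \in signs k by rewrite mem_signs tk.
  by rewrite (big_rem t) //= !asboolT.
rewrite /cnt big_distrl /= big_seq [X in (_ <= X)%N]big_seq; apply: leq_sum => t.
by rewrite mem_signs => /eqP/sK; case: asboolP => // _; rewrite !mul1n.
Qed.

(** * Agreement with a fixed sign pattern *)

Section Agree.
Variable (R : realType).

Fixpoint agree (s e : seq bool) : nat :=
  match s, e with
  | a :: s', b :: e' => ((a == b) + agree s' e')%N
  | _, _ => 0%N
  end.

(** This is the binomial tail bound [(1 + x)^k x^-B] at [x = 1/10]. An agreeing head uses one unit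
    of the budget [B], and the bound satisfies the resulting recursion with equality, since 11/10 *
    10 = 1 + 10. *)
Lemma cnt_agree (k B : nat) (s : seq bool) : size s = k ->
  (cnt k (fun e => agree s e < B)%N)%:R <= (11%:R / 10%:R) ^+ k * 10%:R ^+ B :> R.
Proof.
elim: s k B => [|a s IH] k B.
  move=> <- /=; rewrite cnt0 expr0 mul1r.
  apply: (@le_trans _ _ 1); first by case: asboolP => _ /=; [exact: lexx|exact: ler01].
  by apply: exprn_ege1; lra.
case: k => // k [sk]; case: B => [|B].
  suff -> : cnt k.+1 (fun e => (agree (a :: s) e < 0)%N) = 0%N.
    by rewrite expr0 mulr1 exprn_ge0//; lra.
  by rewrite /cnt big1// => e _; rewrite asboolF.
have := @cntS_le k (fun e => (agree (a :: s) e < B.+1)%N)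
   (fun e => (agree s e < B)%N) (fun e => (agree s e < B.+1)%N).
move=> H; have {H} : (cnt k.+1 (fun e => (agree (a :: s) e < B.+1)%N) <=
    cnt k (fun e => (agree s e < B)%N) + cnt k (fun e => (agree s e < B.+1)%N))%N.
  apply: H => e _; rewrite !asboolb; case: a.
    by rewrite /= add1n add0n ltnS.
  by rewrite /= add1n add0n ltnS addnC.
rewrite -(ler_nat R) natrD => /le_trans; apply.
apply: (le_trans (lerD (IH _ _ sk) (IH _ _ sk))).
rewrite !exprS -subr_ge0.
set x := _ ^+ k; set y := _ ^+ B.
suff -> : 11%:R / 10%:R * x * (10%:R * y) - (x * y + x * (10%:R * y)) = 0 by [].
by field.
Qed.

End Agree.

(** * Linear forms: failing sign vectors by restriction and by budget *)

Section Forms.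
Variables (R : realType) (V : lmodType R) (I : eqType) (f : I -> V -> R).
Hypothesis flin : forall i x t u, f i (x + t *: u) = f i x + t * f i u.

Lemma sgrD_small (a b : R) : `|b| < `|a| -> Num.sg (a + b) = Num.sg a.
Proof.
have [a0|a0|<-] := ltgtP 0 a; last by rewrite normr0 normr_lt0.
- rewrite (gtr0_norm a0) ltr_norml => /andP[b1 b2].
  by rewrite !gtr0_sg //; lra.
- rewrite (ltr0_norm a0) ltr_norml => /andP[b1 b2].
  by rewrite !ltr0_sg //; lra.
Qed.

Lemma perturb (ws : seq I) (x u : V) :
  exists2 t0, 0 < t0 & forall t, `|t| <= t0 -> forall i, i \in ws ->
    f i x != 0 -> Num.sg (f i (x + t *: u)) = Num.sg (f i x).
Proof.
elim: ws => [|i ws [t1 t1_gt0 IH]]; first by exists 1.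
have d_gt0 : 0 < 1 + `|f i u| by rewrite ltr_pwDl.
(* A form vanishing at [x] imposes no constraint. Otherwise this radius gives
   [|t| * |f i u| < |f i x|]; the 1 avoids dividing by zero. *)
exists (if f i x == 0 then t1 else Num.min t1 (`|f i x| / 2 / (1 + `|f i u|))).
  case: eqVneq => // fx0; rewrite lt_min t1_gt0 /= !divr_gt0 ?normr_gt0 //.
move=> t tt j; rewrite inE => /predU1P[-> fx0|jws fx0]; last first.
  apply: IH => //; apply: le_trans tt _; case: ifP => // _.
  by rewrite ge_min lexx.
rewrite flin; apply: sgrD_small; rewrite normrM.
move: tt; rewrite (negbTE fx0) le_min => /andP[_].
rewrite ler_pdivlMr // => tt.
have f0 : 0 < `|f i x| by rewrite normr_gt0.
have : `|t| * `|f i u| <= `|t| * (1 + `|f i u|).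
  by rewrite ler_wpM2l // lerDr.
move=> /le_lt_trans; apply; apply: (le_lt_trans tt); lra.
Qed.

(* [true] stands for the sign [-1], here and in [flip]. *)
Definition npos (e : seq bool) (ws : seq I) (x : V) : nat :=
  count (fun p : bool * I => 0 < (-1) ^+ p.1 * f p.2 x) (zip e ws).

Lemma eq_npos e ws x y :
  {in ws, forall i, Num.sg (f i x) = Num.sg (f i y)} -> npos e ws x = npos e ws y.
Proof.
elim: ws e => [|i ws IH] [|b e] //= H; rewrite /npos /=; congr (_ + _)%N.
  by rewrite -sgr_gt0 sgrM H ?inE ?eqxx // -sgrM sgr_gt0.
by apply: IH => j jw; apply: H; rewrite inE jw orbT.
Qed.

(** The list [vs] records the hyperplanes to which the arrangement [ws] has been restricted, and [B]
    is the budget for positive entries; both change in the recursion. *)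
Definition good (vs ws : seq I) (e : seq bool) (B : nat) : Prop :=
  exists x, [/\ {in vs, forall v, f v x = 0}, {in ws, forall w, f w x != 0}
             & (npos e ws x < B)%N].

(** If the point lies on the hyperplane of [i], a small move along [u] leaves it, stays in the flat
    of [vs] and keeps all signs on [ws]. *)
Lemma good_strict_cons vs ws i e B :
  (exists2 u, {in vs, forall v, f v u = 0} & f i u != 0) ->
  good vs ws e B ->
  exists x, [/\ {in vs, forall v, f v x = 0}, {in i :: ws, forall w, f w x != 0}
             & (npos e ws x < B)%N].
Proof.
move=> [u uvs ui] [x [xvs xws xB]].
have [xi|xi] := eqVneq (f i x) 0; last first.
  exists x; split=> // w; rewrite inE => /predU1P[->//|]; exact: xws.
have [t t_gt0 Ht] := perturb ws x u.
have {}Ht := Ht t; rewrite gtr0_norm // lexx in Ht; have {}Ht := Ht isT.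
exists (x + t *: u); split.
- by move=> v vvs; rewrite flin xvs // uvs // mulr0 addr0.
- move=> w; rewrite inE => /predU1P[->|ww].
    by rewrite flin xi add0r mulf_neq0 // gt_eqF.
  by rewrite -sgr_eq0 Ht ?xws // sgr_eq0 xws.
- by rewrite (@eq_npos _ _ _ x) // => w ww; rewrite Ht // xws.
Qed.

(** One of the two signs makes the new entry negative, at no cost to the budget. *)
Lemma good_cons_one vs ws i e B :
  (exists2 u, {in vs, forall v, f v u = 0} & f i u != 0) ->
  good vs ws e B -> exists b, good vs (i :: ws) (b :: e) B.
Proof.
move=> Hu /(good_strict_cons Hu)[x [xvs xws xB]].
exists (0 < f i x); exists x; split=> //; rewrite /npos /=.
have [xi|xi] := ltP 0 (f i x).
  by rewrite expr1 mulN1r oppr_gt0 ltNge ltW.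
by rewrite expr0 mul1r ltNge xi.
Qed.

Lemma good_cons_slack vs ws i e B b :
  (exists2 u, {in vs, forall v, f v u = 0} & f i u != 0) ->
  good vs ws e B -> good vs (i :: ws) (b :: e) B.+1.
Proof.
move=> Hu /(good_strict_cons Hu)[x [xvs xws xB]]; exists x; split=> //.
by rewrite /npos /= ltnS; apply: leq_trans xB; rewrite -add1n leq_add ?leq_b1.
Qed.

(** A point on the hyperplane of [i] can be pushed to either side of it, so the new signed entry can
    be made negative whatever [b] is. *)
Lemma good_cons_restrict vs ws i e B b :
  (exists2 u, {in vs, forall v, f v u = 0} & f i u != 0) ->
  good (i :: vs) ws e B -> good vs (i :: ws) (b :: e) B.
Proof.
move=> [u uvs ui] [x [xvs xws xB]].
have [t t_gt0 Ht] := perturb ws x u.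
have [c [tc ci]] : exists c, `|c| <= t /\ (-1) ^+ b * (c * f i u) < 0.
  have si : (-1) ^+ b * f i u != 0 by rewrite mulf_neq0 // signr_eq0.
  exists (if 0 < (-1) ^+ b * f i u then - t else t); split.
    by case: ifP => _; rewrite ?normrN gtr0_norm.
  rewrite mulrCA; case: ifP => [s0|/negbT].
    by rewrite mulNr oppr_lt0 mulr_gt0.
  by rewrite -leNgt le_eqVlt (negbTE si) /= => s0; rewrite pmulr_rlt0.
exists (x + c *: u); split.
- by move=> v vvs; rewrite flin xvs ?inE ?vvs ?orbT // uvs // mulr0 addr0.
- move=> w; rewrite inE => /predU1P[->|ww].
    rewrite flin xvs ?inE ?eqxx // add0r.
    by apply: contraTneq ci => ->; rewrite mulr0 ltxx.
  by rewrite -sgr_eq0 Ht ?xws // sgr_eq0 xws.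
rewrite /npos /= flin xvs ?inE ?eqxx // add0r ltNge (ltW ci) add0n.
by rewrite -/(npos e ws _) (@eq_npos _ _ _ x) // => w ww; rewrite Ht // xws.
Qed.

(* Potential for the number of failing sign vectors: [N1] rows are added while
   the dimension [d] of the current space drops, [N2] rows while the budget [B]
   of positive rows drops; each of the two terms satisfies Pascal's recursion in
   its own variable and doubles in the other. *)
Definition fail_bound (N1 N2 d B : nat) : R :=
  2%:R ^+ N2 * (5%:R / 2%:R) ^+ N1 * (2%:R / 3%:R) ^+ d +
  2%:R ^+ N1 * (5%:R / 2%:R) ^+ N2 * (2%:R / 3%:R) ^+ B.

(** The constants 5/2 and 2/3 are tied by 5/2 * 2/3 = 2/3 + 1. *)
Lemma fail_boundS1 N1 N2 d B :
  fail_bound N1.+1 N2 d.+1 B = fail_bound N1 N2 d.+1 B + fail_bound N1 N2 d B.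
Proof. by rewrite /fail_bound !exprS; field. Qed.

Lemma fail_boundS2 N1 N2 d B :
  fail_bound N1 N2.+1 d B.+1 = fail_bound N1 N2 d B.+1 + fail_bound N1 N2 d B.
Proof. by rewrite /fail_bound !exprS; field. Qed.

Lemma fail_bound_trivial N1 N2 d B : (d == 0) || (B == 0) ->
  2%:R ^+ (N1 + N2) <= fail_bound N1 N2 d B.
Proof.
have H (M N : nat) : 2%:R ^+ (M + N) <= 2%:R ^+ N * (5%:R / 2%:R) ^+ M * (2%:R / 3%:R) ^+ 0 :> R.
  rewrite expr0 mulr1 exprD mulrC ler_wpM2l ?exprn_ge0 ?ler0n //.
  by apply: lerXn2r; rewrite ?nnegrE; lra.
have K (M N k : nat) : 0 <= 2%:R ^+ N * (5%:R / 2%:R) ^+ M * (2%:R / 3%:R) ^+ k :> R.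
  by rewrite !mulr_ge0 // exprn_ge0 //; lra.
case/orP => /eqP ->; rewrite /fail_bound.
  by rewrite -[leLHS]addr0 lerD.
by rewrite -[leLHS]add0r lerD // addnC.
Qed.

(** Rows of [us] are removed by spending budget, rows of [ws] by restricting to their hyperplane,
    which lowers the dimension [n - size vs]. The first hypothesis is genericity: fewer than [n]
    forms never force another one to vanish on their common kernel. *)
Lemma cnt_fail (n : nat) (vs us ws : seq I) (B : nat) :
  (forall (vs : seq I) i, uniq (i :: vs) -> (size vs < n)%N ->
     exists2 u, {in vs, forall v, f v u = 0} & f i u != 0) ->
  uniq (us ++ ws ++ vs) ->
  (cnt (size us + size ws) (fun e => ~ good vs (us ++ ws) e B))%:R <=
    fail_bound (size ws) (size us) (n - size vs) B.
Proof.
move=> gp.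
have triv vs' us' ws' B' : (n - size vs' == 0)%N || (B' == 0)%N ->
    (cnt (size us' + size ws') (fun e => ~ good vs' (us' ++ ws') e B'))%:R <=
    fail_bound (size ws') (size us') (n - size vs') B'.
  move=> /(fail_bound_trivial (size ws') (size us')); apply: le_trans.
  by rewrite -natrX ler_nat addnC cnt_le_exp.
elim: us B vs => [|i us IHus] B vs; last first.
  move=> /= /andP[ifr un].
  have [d0|d0] := leqP n (size vs); first by apply: (triv _ (i :: us)); rewrite subn_eq0 d0.
  case: B => [|B]; first by apply: (triv _ (i :: us)); rewrite orbT.
  rewrite addSn fail_boundS2.
  apply: le_trans (lerD (IHus _ _ un) (IHus _ _ un)).
  rewrite -natrD ler_nat; apply: cntS_le => e _.
  have Hu : exists2 u, {in vs, forall v, f v u = 0} & f i u != 0.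
    apply: gp => //=; move: ifr un; rewrite !mem_cat !cat_uniq !negb_or.
    by move=> /and3P[_ _ ->] /and3P[_ _ /and3P[]].
  (* If the tail is good with budget [B], no head fails; if it is good with [B.+1], at most one
     does; otherwise both may fail, and both terms on the right are 1. *)
  case: (asboolP (~ good vs (us ++ ws) e B)) => [_|/contrapT g]; last first.
    have gg b := good_cons_slack b Hu g.
    by rewrite (asbool_notF (gg true)) (asbool_notF (gg false)).
  case: (asboolP (~ good vs (us ++ ws) e B.+1)) => [_|/contrapT g].
    by rewrite (leq_add (leq_b1 _) (leq_b1 _)).
  have [[] gb] := good_cons_one Hu g;
    by rewrite (asbool_notF gb) ?addn0 ?add0n (leq_trans (leq_b1 _)) // leq_addl.
elim: ws vs B => [|i ws IHws] vs B.
  move=> _; case: B => [|B]; first by apply: (triv _ [::] [::]); rewrite orbT.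
  rewrite /= cnt0 asbool_notF.
    by apply: addr_ge0; rewrite !mulr_ge0 // exprn_ge0 //; lra.
  (* With no rows left and a positive budget the origin is good; [flin] gives that the forms vanish
     there. *)
  exists 0; split=> // v _.
  have := flin v 0 1 0; rewrite scaler0 addr0 mul1r => /eqP.
  by rewrite addrC -subr_eq subrr eq_sym => /eqP.
rewrite /= => /andP[ifr un].
have [d0|d0] := leqP n (size vs); first by apply: (triv _ [::] (i :: ws)); rewrite subn_eq0 d0.
have un' : uniq (ws ++ i :: vs) by rewrite (uniq_catCA ws [:: i] vs) /= ifr.
rewrite add0n -[(n - size vs)%N]prednK ?subn_gt0 // fail_boundS1 prednK ?subn_gt0 //.
have := IHws (i :: vs) B un'; rewrite /= subnS => IH2.
apply: le_trans (lerD (IHws _ _ un) IH2); rewrite !add0n.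
rewrite -natrD ler_nat; apply: cntS_le => e _.
have Hu : exists2 u, {in vs, forall v, f v u = 0} & f i u != 0.
  apply: gp => //=; move: ifr un; rewrite mem_cat cat_uniq negb_or.
  by move=> /andP[_ ->] /and3P[].
rewrite addnC [X in (_ <= X)%N]addnC.
(* The same trichotomy, with restriction to the hyperplane of [i] in place of the smaller budget. *)
case: (asboolP (~ good (i :: vs) ws e B)) => [_|/contrapT g]; last first.
  have gg b := good_cons_restrict b Hu g.
  by rewrite (asbool_notF (gg true)) (asbool_notF (gg false)).
case: (asboolP (~ good vs ws e B)) => [_|/contrapT g].
  by rewrite (leq_add (leq_b1 _) (leq_b1 _)).
have [[] gb] := good_cons_one Hu g;
  by rewrite (asbool_notF gb) ?addn0 ?add0n (leq_trans (leq_b1 _)) // leq_addl.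
Qed.

End Forms.

(** * Sign patterns of a matrix *)

Section Patterns.
Variables (R : realType) (n : nat) (I : eqType) (phi : I -> 'cV[R]_n).

Let g (i : I) (x : 'rV[R]_n) : R := (x *m phi i) 0 0.

Definition realized (U : 'M[R]_n) (ws : seq I) (s : seq bool) : Prop :=
  exists x, [/\ (x <= U)%MS, {in ws, forall i, g i x != 0}
             & s = [seq g i x < 0 | i <- ws]].

Lemma realized_behead U i ws b s : realized U (i :: ws) (b :: s) -> realized U ws s.
Proof.
move=> [x [xU xw [_ ->]]]; exists x; split=> // j jw.
by apply: xw; rewrite inE jw orbT.
Qed.

(* The segment joining two points on opposite sides of a hyperplane crosses it
   without changing the other signs. *)
Lemma realized_cross U i ws s :
  realized U (i :: ws) (true :: s) -> realized U (i :: ws) (false :: s) ->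
  realized (U :&: kermx (phi i))%MS ws s.
Proof.
move=> [x [xU xw [xi sx]]] [y [yU yw [yi sy]]].
have yi0 : 0 < g i y by rewrite lt_neqAle eq_sym yw ?inE ?eqxx // leNgt -yi.
have xi0 : 0 < - g i x by rewrite oppr_gt0 -xi.
have gz j : g j (g i y *: x - g i x *: y) = g i y * g j x + (- g i x) * g j y.
  by rewrite /g mulmxBl -!scalemxAl !mxE mulNr.
have sxy : {in ws, forall j, (g j x < 0) = (g j y < 0)}.
  by apply/eq_in_map; rewrite -sx -sy.
have sz j : j \in ws -> (g j (g i y *: x - g i x *: y) != 0) /\
    (g j (g i y *: x - g i x *: y) < 0) = (g j x < 0).
  move=> jw; rewrite gz.
  have xj : g j x != 0 by apply: xw; rewrite inE jw orbT.
  have yj : g j y != 0 by apply: yw; rewrite inE jw orbT.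
  have := sxy j jw; have [xj0|xj0] := ltP (g j x) 0.
    move=> /esym yj0; have : g i y * g j x + - g i x * g j y < 0.
      by rewrite ltr_nDl // pmulr_rlt0.
    by move=> h; rewrite h lt_eqF.
  move=> /esym/negbT; rewrite -leNgt => yj0.
  have : 0 < g i y * g j x + - g i x * g j y.
    by rewrite ltr_wpDr // ?mulr_gt0 // ?mulr_ge0 // ?ltW // lt_neqAle eq_sym xj.
  by move=> h; rewrite gt_eqF // lt_gtF.
exists (g i y *: x - g i x *: y); split.
- rewrite sub_capmx; apply/andP; split.
    by rewrite addmx_sub // ?eqmx_opp ?scalemx_sub.
  apply/sub_kermxP/matrixP => a b; rewrite !ord1.
  by rewrite -[LHS]/(g i (g i y *: x - g i x *: y)) gz mulNr mulrC subrr mxE.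
- by move=> j /sz[].
- by rewrite sx; apply/eq_in_map => j /sz[_ ->].
Qed.

(** Deletion-restriction: a pattern of [ws] extends in both ways only if it is realized on the
    hyperplane of the new form, where the rank is smaller. Again [x = 1/10]: 11/10 * 10^r = 10^r +
    10^(r-1). *)
Lemma cnt_realized (ws : seq I) (U : 'M[R]_n) :
  (cnt (size ws) (realized U ws))%:R <= (11%:R / 10%:R) ^+ size ws * 10%:R ^+ \rank U :> R.
Proof.
elim: ws U => [|i ws IH] U.
  rewrite cnt0 expr0 mul1r; apply: (@le_trans _ _ 1).
    by case: asboolP => _ /=; [exact: lexx|exact: ler01].
  by apply: exprn_ege1; lra.
have [Ui|Ui] := boolP (U <= kermx (phi i))%MS.
  (* A form vanishing on all of [U] leaves no point with nonzero entries. *)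
  suff -> : cnt (size (i :: ws)) (realized U (i :: ws)) = 0%N.
    by rewrite mulr_ge0 // exprn_ge0 //; lra.
  rewrite /cnt big1// => e _; rewrite asboolF // => -[x [xU xw _]].
  have /sub_kermxP xi := submx_trans xU Ui.
  by have := xw i; rewrite inE eqxx /g xi mxE eqxx => /(_ isT).
have rU : (\rank (U :&: kermx (phi i))%MS < \rank U)%N.
  rewrite ltn_neqAle mxrankS ?capmxSl // andbT.
  apply: contra Ui => /eqP rk.
  have := mxrank_leqif_eq (capmxSl U (kermx (phi i))) => -[_].
  by rewrite rk eqxx => /esym/andP[_ /submx_trans]; apply; rewrite capmxSr.
have /= : (cnt (size ws).+1 (realized U (i :: ws)) <=
    cnt (size ws) (realized U ws) +
    cnt (size ws) (realized (U :&: kermx (phi i))%MS ws))%N.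
  apply: cntS_le => e _.
  have [/asboolP|/asboolP] := boolP `[< realized U (i :: ws) (true :: e) >] => h1;
  have [/asboolP|/asboolP] := boolP `[< realized U (i :: ws) (false :: e) >] => h2.
  - rewrite (asboolT (realized_behead h1)) (asboolT (realized_cross h1 h2)) //.
  - by rewrite (asboolT (realized_behead h1)).
  - by rewrite (asboolT (realized_behead h2)).
  - by [].
rewrite -(ler_nat R) natrD => /le_trans; apply.
apply: (le_trans (lerD (IH _) (IH _))).
have : 10%:R ^+ \rank (U :&: kermx (phi i))%MS <= 10%:R ^+ \rank U / 10%:R :> R.
  rewrite ler_pdivlMr; last lra.
  by rewrite -exprSr ler_weXn2l //; lra.
rewrite exprS; set a := _ ^+ size ws; set b := _ ^+ \rank _; set c := _ ^+ \rank _ => cb.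
have a0 : 0 <= a by rewrite exprn_ge0 //; lra.
by have := ler_wpM2l a0 cb; lra.
Qed.

End Patterns.

(** * Row sign flips of a matrix *)

Section SignedMatrix.
Variables (R : realType) (m n : nat).
Implicit Types (W : 'M[R]_(m, n)) (e : seq bool).

Definition flip e W : 'M[R]_(m, n) := \matrix_(i, j) ((-1) ^+ nth false e i * W i j).

Definition few_positive W : Prop :=
  exists y : 'cV[R]_n, (forall i, (W *m y) i 0 != 0) /\
    (#|[pred i : 'I_m | (0 < (W *m y) i ord0)%R]| < n)%N.

(** Written on row vectors so that subspaces can be row spaces, as in [realized]. *)
Definition rowform W (i : 'I_m) (x : 'rV[R]_n) : R := (x *m col i W^T) 0 0.

Lemma rowform_lin W i x t u :
  rowform W i (x + t *: u) = rowform W i x + t * rowform W i u.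
Proof. by rewrite /rowform mulmxDl -scalemxAl !mxE. Qed.

Lemma rowformE W i (y : 'cV[R]_n) : rowform W i y^T = (W *m y) i 0.
Proof. by rewrite /rowform !mxE; apply: eq_bigr => j _; rewrite !mxE mulrC. Qed.

Lemma flipE e W (y : 'cV[R]_n) i :
  (flip e W *m y) i 0 = (-1) ^+ nth false e i * (W *m y) i 0.
Proof. by rewrite !mxE big_distrr /=; apply: eq_bigr => j _; rewrite mxE mulrA. Qed.

Lemma nposE e W (y : 'cV[R]_n) : size e = m ->
  npos (rowform W) e (enum 'I_m) y^T = #|[pred i : 'I_m | 0 < (flip e W *m y) i ord0]|.
Proof.
move=> em; have -> : #|[pred i : 'I_m | 0 < (flip e W *m y) i ord0]| =
    count (fun i => 0 < (flip e W *m y) i ord0) (enum 'I_m).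
  by rewrite -sum1_card -sum1_count big_enum_cond.
rewrite /npos; have -> : zip e (enum 'I_m) = [seq (nth false e (i : 'I_m), i) | i <- enum 'I_m].
  have [m0|m_gt0] := posnP m.
    have -> : enum 'I_m = [::] by apply: size0nil; rewrite size_enum_ord.
    by case: (e).
  pose i0 := Ordinal m_gt0.
  apply: (@eq_from_nth _ (false, i0)); first by rewrite size_zip size_map em size_enum_ord minnn.
  move=> k; rewrite size_zip em size_enum_ord minnn => km.
  rewrite nth_zip ?em ?size_enum_ord // (nth_map i0) ?size_enum_ord //.
  by congr (nth _ _ _, _); rewrite nth_enum_ord.
by rewrite count_map; apply: eq_count => i; rewrite /= rowformE flipE.
Qed.

Lemma few_positiveP e W : size e = m ->
  few_positive (flip e W) <-> good (rowform W) [::] (enum 'I_m) e n.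
Proof.
move=> em; split=> [[y [yi yn]]|[x [_ xi xn]]].
  exists y^T; split => [//|i _|]; last by rewrite nposE.
  by have := yi i; rewrite flipE rowformE mulf_eq0 negb_or => /andP[].
exists x^T; split=> [i|]; last by rewrite -nposE // trmxK.
by rewrite flipE mulf_neq0 ?signr_eq0 // -rowformE trmxK xi // mem_enum.
Qed.

(** A signed entry is positive exactly when its sign bit equals the bit telling that the entry is
    negative. *)
Lemma npos_agree W e x (ws : seq 'I_m) : size e = size ws ->
  {in ws, forall i, rowform W i x != 0} ->
  npos (rowform W) e ws x = agree [seq rowform W i x < 0 | i <- ws] e.
Proof.
elim: ws e => [|i ws IH] [|b e] //= [ew] xw; rewrite /npos /=; congr (_ + _)%N; last first.
  by apply: IH => // j jw; apply: xw; rewrite inE jw orbT.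
have : rowform W i x != 0 by apply: xw; rewrite inE eqxx.
case: b; rewrite ?expr0 ?expr1 ?mul1r ?mulN1r ?oppr_gt0 /=; case: ltgtP => //.
Qed.

Lemma cnt_few_positive W :
  (cnt m (fun e => few_positive (flip e W)))%:R <=
    ((11%:R / 10%:R) ^+ m * 10%:R ^+ n) ^+ 2 :> R.
Proof.
(* A natural number bounding the agreement count uniformly in the pattern, as the union bound
   requires. *)
pose C := \big[maxn/0%N]_(s <- signs m) cnt m (fun e => agree s e < n)%N.
have CP s : size s = m -> (cnt m (fun e => agree s e < n)%N <= C)%N.
  by move=> sm; apply: leq_bigmax_seq => //; rewrite mem_signs sm.
have : (cnt m (fun e => few_positive (flip e W)) <=
   cnt m (realized (fun i => col i W^T) 1%:M (enum 'I_m)) * C)%N.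
  apply: cnt_exists_le CP => e em /(few_positiveP W em)[x [_ xw xn]].
  exists [seq rowform W i x < 0 | i <- enum 'I_m]; first by rewrite size_map size_enum_ord.
  split; last by rewrite -npos_agree // size_enum_ord.
  by exists x; split=> //; rewrite submx1.
rewrite -(ler_nat R) natrM expr2 => /le_trans; apply.
apply: ler_pM; rewrite ?ler0n //.
  by have := cnt_realized (fun i => col i W^T) (enum 'I_m) 1%:M; rewrite size_enum_ord mxrank1.
rewrite /C big_seq; elim/big_ind: _ => [|a b|s].
- by apply: mulr_ge0; apply: exprn_ge0; lra.
- by rewrite /maxn; case: ifP.
- by rewrite mem_signs => /eqP sm; exact: cnt_agree.
Qed.

End SignedMatrix.

(** * Generic matrices and injectivity *)

(** The hyperplanes of [ws] are left one at a time, by moves small enough to keep every nonzero sign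
    already reached. *)
Lemma perturb_nonzero (R : realType) (V : lmodType R) (I : eqType) (f : I -> V -> R)
    (ws us : seq I) (z : V) :
  (forall i x t u, f i (x + t *: u) = f i x + t * f i u) ->
  {in ws, forall i, exists u, f i u != 0} ->
  exists x, {in ws, forall i, f i x != 0} /\
    {in us, forall i, f i z != 0 -> Num.sg (f i x) = Num.sg (f i z)}.
Proof.
move=> flin; elim: ws => [|i ws IH] H; first by exists z.
have [|x [xw xu]] := IH; first by move=> j jw; apply: H; rewrite inE jw orbT.
have [xi|xi] := eqVneq (f i x) 0; last first.
  by exists x; split=> // j; rewrite inE => /predU1P[->|/xw].
have [u ui] := H i (mem_head _ _).
have [t t_gt0 Ht] := perturb flin (ws ++ us) x u.
have {}Ht := Ht t; rewrite gtr0_norm // lexx in Ht; have {}Ht := Ht isT.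
exists (x + t *: u); split.
- move=> w; rewrite inE => /predU1P[->|ww].
    by rewrite flin xi add0r mulf_neq0 // gt_eqF.
  by rewrite -sgr_eq0 Ht ?mem_cat ?ww ?xw // sgr_eq0 xw.
- move=> j ju zj; rewrite Ht ?mem_cat ?ju ?orbT ?xu //.
  by rewrite -sgr_eq0 xu // sgr_eq0.
Qed.

Section Generic.
Variables (R : realType) (m n : nat).
Implicit Types (W : 'M[R]_(m, n)) (e : seq bool).

Definition generic W : Prop :=
  forall f : 'I_n -> 'I_m, injective f ->
  forall y : 'cV[R]_n, (forall k, (W *m y) (f k) 0 = 0) -> y = 0.

Lemma generic_flip e W : generic (flip e W) -> generic W.
Proof.
move=> gW f finj y fy; apply: (gW f finj) => k.
by rewrite flipE fy mulr0.
Qed.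

Lemma generic_card W (J : {pred 'I_m}) (y : 'cV[R]_n) : generic W ->
  y != 0 -> {in J, forall i, (W *m y) i 0 = 0} -> (#|J| < n)%N.
Proof.
move=> gW y0 yJ; rewrite ltnNge; apply/negP => nJ.
case/eqP: y0; apply: (gW (fun k => enum_val (widen_ord nJ k))) => [k l /enum_val_inj|k].
  by move=> /(congr1 val)/= /val_inj.
by apply: yJ; exact: enum_valP.
Qed.

(** Complete [i :: vs] to [n] distinct rows. They form an invertible matrix, so some vector has
    value 1 on row [i] and 0 on the other chosen rows. *)
Lemma generic_separate W (vs : seq 'I_m) i : (n <= m)%N -> generic W ->
  uniq (i :: vs) -> (size vs < n)%N ->
  exists2 u, {in vs, forall v, rowform W v u = 0} & rowform W i u != 0.
Proof.
move=> nm gW un sn.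
pose s := (i :: vs) ++ [seq j <- enum 'I_m | j \notin i :: vs].
have us : uniq s.
  rewrite cat_uniq un filter_uniq ?enum_uniq // andbT /=.
  by apply/hasPn => j; rewrite mem_filter => /andP[].
have ss : size s = m.
  rewrite -[RHS]size_enum_ord; apply/perm_size/uniq_perm => //; first exact: enum_uniq.
  by move=> j; rewrite mem_cat mem_filter mem_enum andbT orbN.
pose f (k : 'I_n) := nth i s k.
have finj : injective f.
  move=> k l /eqP; rewrite nth_uniq // ?ss ?(leq_trans _ nm) // => /eqP; exact: val_inj.
pose A := rowsub f W.
have AE (y : 'cV_n) k : (A *m y) k 0 = (W *m y) (f k) 0.
  by rewrite !mxE; apply: eq_bigr => j _; rewrite !mxE.
have uA : A \in unitmx.
  rewrite -unitmx_tr -row_free_unit -kermx_eq0; apply/eqP/row_matrixP => k.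
  rewrite row0; set y := row k _.
  have yA : y *m A^T = 0 by apply/sub_kermxP; exact: row_sub.
  suff : y^T = 0 by move/(congr1 trmx); rewrite trmxK trmx0.
  apply: (gW f finj) => l; rewrite -AE.
  by rewrite -[A]trmxK -trmx_mul yA !mxE.
have n_gt0 : (0 < n)%N by apply: leq_trans sn.
pose k0 := Ordinal n_gt0.
pose y : 'cV[R]_n := invmx A *m delta_mx k0 0.
have Ay : A *m y = delta_mx k0 0 by rewrite mulKVmx.
exists y^T => [v vvs|].
  have vk : ((index v vs).+1 < n)%N by apply: leq_ltn_trans sn; rewrite index_mem.
  have fv : f (Ordinal vk) = v by rewrite /f /s /= nth_cat index_mem vvs nth_index.
  by rewrite rowformE -fv -AE Ay mxE.
have fi : f k0 = i by [].
by rewrite rowformE -{1}fi -AE Ay mxE !eqxx oner_eq0.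
Qed.

(** The first [m./2] rows spend the budget of [n] positive entries, the remaining rows spend the [n]
    dimensions. *)
Lemma cnt_not_few_positive W : (n <= m)%N -> generic W ->
  (cnt m (fun e => ~ few_positive (flip e W)))%:R <=
    fail_bound R (m - m./2) m./2 n n.
Proof.
move=> nm gW; have sm : (m./2 <= m)%N by rewrite -divn2 leq_div.
have := @cnt_fail R _ _ (rowform W) (rowform_lin W) n [::]
  (take m./2 (enum 'I_m)) (drop m./2 (enum 'I_m)) n.
rewrite cats0 cat_take_drop enum_uniq size_drop !size_take_min !size_enum_ord (minn_idPl sm) subn0.
rewrite subnKC // => H; apply: le_trans (H _ isT).
  by rewrite ler_nat; apply: leq_cnt => e em h1 /(few_positiveP W em).
by move=> vs i; apply: generic_separate.
Qed.

Lemma small_kernel W (J : {pred 'I_m}) : (#|J| < n)%N ->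
  exists2 v : 'cV[R]_n, v != 0 & {in J, forall i, (W *m v) i 0 = 0}.
Proof.
move=> Jn; pose A := rowsub (fun k : 'I_#|J| => enum_val k) W.
have : kermx A^T != 0.
  rewrite kermx_eq0 /row_free mxrank_tr; apply: contraTneq Jn => rk.
  by rewrite -leqNgt -{1}rk rank_leq_row.
case/rowV0Pn => v /sub_kermxP vA v0; exists v^T.
  by apply: contra v0 => /eqP/(congr1 trmx); rewrite trmxK trmx0 => ->.
move=> i iJ; have := congr1 (fun B : 'rV_#|J| => B 0 (enum_rank_in iJ i)) vA.
rewrite !mxE => E; rewrite -[RHS]E; apply: eq_bigr => j _.
by rewrite !mxE enum_rankK_in // mulrC.
Qed.

(* Take [v = x - x'] and [z = x + x'], and conversely [x = z + t v], [x' = z] with [t] small. *)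
Lemma not_relu_injectiveP W :
  ~ relu_injective W <->
  exists J : {set 'I_m},
    (exists2 v : 'cV[R]_n, v != 0 & {in J, forall i, (W *m v) i 0 = 0}) /\
    exists z : 'cV[R]_n, forall i, i \notin J -> (W *m z) i 0 < 0.
Proof.
split=> [|[J [[v v0 vJ] [z zJ]]] inj].
  move=> /existsNP[x /existsNP[y /not_implyP[xy /eqP nxy]]].
  exists [set i | (W *m (x - y)) i 0 == 0]%SET; split.
    exists (x - y); first by rewrite subr_eq0.
    by move=> i; rewrite inE => /eqP.
  exists (x + y) => i; rewrite inE mulmxBr mulmxDr !mxE.
  have /(congr1 (fun B : 'cV_m => B i 0)) := xy; rewrite !mxE.
  set a := \sum_j _; set b := \sum_j _.
  (* Distinct numbers have equal positive parts only if both are at most 0, and then their sum is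
     negative. *)
  rewrite subr_eq0 neq_lt => E /orP ab; move: E; rewrite /Num.max.
  by case: (ltP a 0) => ?; case: (ltP b 0) => ? ?; case: ab => ?; lra.
have flin i (x : 'cV_n) t u : (W *m (x + t *: u)) i 0 = (W *m x) i 0 + t * (W *m u) i 0.
  by rewrite mulmxDr -scalemxAr !mxE.
have [t t_gt0 Ht] := perturb flin (enum 'I_m) z v.
have {}Ht := Ht t; rewrite gtr0_norm // lexx in Ht; have {}Ht := Ht isT.
have /inj /eqP : relu (W *m (z + t *: v)) = relu (W *m z).
  apply/matrixP => i j; rewrite !ord1 [LHS]mxE [RHS]mxE.
  have [iJ|iJ] := boolP (i \in J); first by rewrite flin vJ // mulr0 addr0.
  have zi := zJ _ iJ; rewrite !max_r ?ltW //.
  by rewrite -sgr_lt0 Ht ?sgr_lt0 ?mem_enum // lt_eqF.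
by rewrite -subr_eq0 addrAC subrr add0r scaler_eq0 gt_eqF // (negbTE v0).
Qed.

Lemma few_positive_not_injective W : few_positive W -> ~ relu_injective W.
Proof.
move=> [y [yi yn]]; apply/not_relu_injectiveP.
exists [set i | 0 < (W *m y) i ord0]%SET; split.
  by apply: small_kernel; rewrite cardsE.
exists y => i; rewrite inE -leNgt => le0; by rewrite lt_neqAle yi.
Qed.

(** Perturb [z] so that no entry vanishes; rows outside [J] stay negative, so the positive ones lie
    in [J], which has fewer than [n] elements by genericity. *)
Lemma generic_few_positive W : (0 < n <= m)%N -> generic W ->
  ~ relu_injective W -> few_positive W.
Proof.
move=> /andP[n_gt0 nm] gW /not_relu_injectiveP[J [[v v0 vJ] [z zJ]]].
have Jn := generic_card gW v0 vJ.
have [|x [xi xz]] := @perturb_nonzero _ _ _ (rowform W) (enum 'I_m) (enum 'I_m) z^T (rowform_lin W).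
  by move=> i _; have [u _ ui] := @generic_separate W [::] i nm gW isT n_gt0; exists u.
exists x^T; split=> [i|]; first by rewrite -rowformE trmxK xi // mem_enum.
apply: leq_ltn_trans Jn; apply: subset_leq_card; apply/fintype.subsetP => i; rewrite inE => xi0.
have [//|iJ] := boolP (i \in J); have zi := zJ i iJ.
have := xz i (mem_enum _ _); rewrite rowformE lt_eqF // => /(_ isT).
rewrite (ltr0_sg zi) gtr0_sg; first lra.
by rewrite -[x]trmxK rowformE.
Qed.

Lemma not_relu_injective_wide W : (m < n)%N -> ~ relu_injective W.
Proof.
move=> mn; apply/not_relu_injectiveP; exists [set: 'I_m]%SET; split.
  by apply: small_kernel; rewrite cardsT card_ord.
by exists 0 => i; rewrite inE.
Qed.

End Generic.

(** * The law of a Gaussian matrix *)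

(** The sets to which the product rule of [iid_std_normal] applies. They form a pi-system generating
    the sigma-algebra chosen on matrices, so they determine the law. *)
Definition boxes (R : realType) (m n : nat) : set (set 'M[R]_(m, n)) :=
  [set E | exists2 B : 'I_m -> 'I_n -> set R, (forall i j, measurable (B i j))
     & E = [set M : 'M[R]_(m, n) | forall i j, B i j (M i j)]].

Notation mxT R m n := (g_sigma_algebraType (@boxes R m n)).

Section MatrixSpace.
Variables (R : realType) (m n : nat).

Lemma boxesI : setI_closed (@boxes R m n).
Proof.
move=> _ _ [A mA ->] [B mB ->]; exists (fun i j => A i j `&` B i j).
  by move=> i j; exact: measurableI.
by apply/seteqP; split=> [M [MA MB] i j|M MAB]; [split|split=> i j; case: (MAB i j)].
Qed.

Lemma boxesT : boxes [set: 'M[R]_(m, n)].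
Proof. by exists (fun _ _ => setT) => //; apply/seteqP; split. Qed.

Lemma measurable_entry i j : measurable_fun [set: mxT R m n] (fun M : mxT R m n => M i j).
Proof.
move=> _ A mA; rewrite setTI; apply: sub_sigma_algebra.
exists (fun a b => if (a == i) && (b == j) then A else setT).
  by move=> a b; case: ifP.
apply/seteqP; split=> [M MA a b|M /(_ i j)]; last by rewrite !eqxx.
by case: ifP => // /andP[/eqP-> /eqP->].
Qed.

Lemma measurable_to_mx d (T : measurableType d) (X : T -> mxT R m n) :
  (forall i j, measurable_fun setT (fun w => (X w : 'M[R]_(m, n)) i j)) ->
  measurable_fun setT X.
Proof.
move=> mX; apply: (@measurability _ _ T (mxT R m n) setT X (@boxes R m n) erefl) => _ [_ [B mB ->] <-].
rewrite setTI (_ : _ @^-1` _ = \bigcap_i \bigcap_j ((fun w => X w i j) @^-1` B i j)).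
  apply: fin_bigcap_measurable => // i _; apply: fin_bigcap_measurable => // j _.
  by rewrite -[X in measurable X]setTI; exact: mX.
by apply/seteqP; split=> [w Bw i _ j _|w Bw i j]; [exact: Bw|exact: Bw].
Qed.

Lemma mx_law_unique (mu nu : {measure set (mxT R m n) -> \bar R}) :
  (mu setT < +oo)%E ->
  (forall B : 'I_m -> 'I_n -> set R, (forall i j, measurable (B i j)) ->
     mu [set M : 'M[R]_(m, n) | forall i j, B i j (M i j)] =
     nu [set M : 'M[R]_(m, n) | forall i j, B i j (M i j)]) ->
  forall E, measurable E -> mu E = nu E.
Proof.
move=> muoo H E mE.
apply: (@measure_unique _ _ (mxT R m n) (@boxes R m n) (fun=> setT)) => //.
- exact: boxesI.
- by move=> _; exact: boxesT.
- by rewrite bigcup_const.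
- by move=> _ [B mB ->]; exact: H.
Qed.

End MatrixSpace.

Lemma measurable_det d (T : measurableType d) (R : realType) (k : nat) (A : T -> 'M[R]_k) :
  (forall i j, measurable_fun setT (fun w => A w i j)) ->
  measurable_fun setT (fun w => \det (A w)).
Proof.
move=> mA; apply: measurable_sum => s; apply: measurable_funM => //.
by apply: measurable_prod => i _; exact: mA.
Qed.

Lemma measurable_mul_entry d (T : measurableType d) (R : realType) (k l p : nat)
    (A : T -> 'M[R]_(k, l)) (B : T -> 'M[R]_(l, p)) :
  (forall i j, measurable_fun setT (fun w => A w i j)) ->
  (forall i j, measurable_fun setT (fun w => B w i j)) ->
  forall i j, measurable_fun setT (fun w => (A w *m B w) i j).
Proof.
move=> mA mB i j; under eq_fun do rewrite mxE.
by apply: measurable_sum => a; apply: measurable_funM.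
Qed.

(** The density is even and Lebesgue measure is invariant under reflection. *)
Lemma normal_prob_sym (R : realType) (A : set R) : measurable A ->
  normal_prob 0 1 (-%R @^-1` A) = normal_prob 0 1 A :> \bar R.
Proof.
move=> mA; rewrite /normal_prob.
have pdfN x : normal_pdf 0 1 (- x) = normal_pdf 0 1 x :> R.
  by rewrite !normal_pdfE ?oner_eq0 // /normal_fun !subr0 sqrrN.
transitivity (\int[lebesgue_measure]_(x in (-%R : R -> measurableTypeR R) @^-1` A)
   (((fun x => (normal_pdf 0 1 x)%:E) : R -> \bar R) \o (-%R : R -> measurableTypeR R)) x)%E.
  by apply: eq_integral => x _; rewrite /= pdfN.
rewrite -ge0_integral_pushforward//=.
- by apply: eq_measure_integral => B mB BA; exact: lebesgue_measureN.
- apply: measurable_funTS; apply/measurable_EFinP; exact: measurable_normal_pdf.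
- by move=> y _; rewrite lee_fin normal_pdf_ge0.
Qed.

Lemma normal_prob_set1 (R : realType) (a : R) : normal_prob 0 1 [set a] = 0 :> \bar R.
Proof.
have := @normal_prob_dominates R 0 1 => /null_content_dominatesP; apply => //.
exact: lebesgue_measure_set1.
Qed.

Section Law.
Variables (R : realType) (m n : nat) (d : measure_display) (T : measurableType d).
Variables (P : probability T R) (W : 'I_m -> 'I_n -> {RV P >-> R}).
Hypothesis iidW : iid_std_normal P W.

Lemma measurable_rand_mx : measurable_fun setT (rand_mx W : T -> mxT R m n).
Proof.
apply: measurable_to_mx => i j; under eq_fun do rewrite mxE; exact: measurable_funP.
Qed.

Lemma measurable_flip e : measurable_fun setT (flip e : mxT R m n -> mxT R m n).
Proof.
apply: measurable_to_mx => i j; under eq_fun do rewrite mxE.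
by apply: measurable_funM => //; exact: measurable_entry.
Qed.

(** On a box, flipping a row reflects its Borel sets, which keeps their normal mass; boxes then
    determine the law. *)
Lemma flip_law e (E : set (mxT R m n)) : measurable E ->
  P [set w | E (flip e (rand_mx W w))] = P [set w | E (rand_mx W w)].
Proof.
move=> mE; have mf : measurable_fun setT (flip e \o rand_mx W : T -> mxT R m n).
  exact: (measurableT_comp (measurable_flip e) measurable_rand_mx).
have mW := measurable_rand_mx.
apply: (@mx_law_unique _ _ _
  (measure_function_pushforward__canonical__measure_function_Measure P mf)
  (measure_function_pushforward__canonical__measure_function_Measure P mW)) => //=.
  by rewrite /pushforward /= preimage_setT probability_setT ltry.
move=> B mB; rewrite /pushforward /=.
have [law indep] := iidW.
pose B' (i : 'I_m) (j : 'I_n) := if nth false e i then -%R @^-1` B i j else B i j.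
have mB' i j : measurable (B' i j).
  rewrite /B'; case: ifP => // _; rewrite -[X in measurable X]setTI.
  exact: oppr_measurable.
rewrite [X in P X = _](_ : _ = [set w | forall i j, B' i j (W i j w)]); last first.
  apply/seteqP; split=> w /= H i j; have := H i j; rewrite /B' !mxE;
  by case: (nth false e i); rewrite ?expr1 ?expr0 ?mulN1r ?mul1r.
rewrite [X in _ = P X](_ : _ = [set w | forall i j, B i j (W i j w)]); last first.
  by apply/seteqP; split=> w /= H i j; have := H i j; rewrite mxE.
rewrite !indep //; apply: eq_bigr => i _; apply: eq_bigr => j _.
by rewrite !law // /B'; case: ifP => // _; rewrite normal_prob_sym.
Qed.

Variables (i0 : 'I_m) (j0 : 'I_n).

(** Carries all entries except [(i0, j0)] without changing the matrix type; it is the part of the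
    matrix independent of that entry. *)
Definition zero_entry (M : 'M[R]_(m, n)) : 'M[R]_(m, n) :=
  \matrix_(i, j) if (i == i0) && (j == j0) then 0 else M i j.

Lemma measurable_zero_rand_mx :
  measurable_fun setT (zero_entry \o rand_mx W : T -> mxT R m n).
Proof.
apply: measurable_to_mx => i j; under eq_fun do rewrite /= !mxE.
by case: (_ && _); [exact: measurable_cst|exact: measurable_funP].
Qed.

(** For fixed [C] both sides are finite measures in [A], so it suffices to compare them on boxes. *)
Lemma indep_entry (A : set (mxT R m n)) (C : set R) : measurable A -> measurable C ->
  P ([set w | A (zero_entry (rand_mx W w))] `&` W i0 j0 @^-1` C) =
  (P [set w | A (zero_entry (rand_mx W w))] * normal_prob 0 1 C)%E.
Proof.
move=> mA mC; have [law indep] := iidW.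
have mX : measurable (W i0 j0 @^-1` C) by rewrite -[X in measurable X]setTI; exact: measurable_funP.
have mZ := measurable_zero_rand_mx.
have rfin : normal_prob 0 1 C \is a fin_num by rewrite -(law i0 j0) // fin_num_measure.
have r0 : 0 <= fine (normal_prob 0 1 C) by rewrite fine_ge0 // -(law i0 j0).
pose mu1 : {measure set T -> \bar R} := mrestr P mX.
pose mu := measure_function_pushforward__canonical__measure_function_Measure mu1 mZ.
pose nu0 := measure_function_pushforward__canonical__measure_function_Measure P mZ.
pose nu : {measure set (mxT R m n) -> \bar R} := mscale (NngNum r0) nu0.
have muE X : mu X = P ((zero_entry \o rand_mx W) @^-1` X `&` W i0 j0 @^-1` C) by [].
have nuE X : nu X = (normal_prob 0 1 C * P ((zero_entry \o rand_mx W) @^-1` X))%E.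
  by rewrite /nu /= /mscale /= fineK.
suff : mu A = nu A.
  by rewrite muE nuE muleC.
apply: mx_law_unique => //.
  by rewrite muE preimage_setT setTI (le_lt_trans (probability_le1 _ _)) // ltry.
move=> B mB; rewrite muE nuE.
(* At the erased entry the box condition no longer depends on [w]: it only asks whether 0 belongs to
   [B i0 j0]. *)
pose ok := asbool (B i0 j0 0).
pose B1 i j := if (i == i0) && (j == j0) then (if ok then C else set0) else B i j.
pose B2 i j := if (i == i0) && (j == j0) then (if ok then setT else set0) else B i j.
have mB1 i j : measurable (B1 i j) by rewrite /B1; do 2?case: ifP.
have mB2 i j : measurable (B2 i j) by rewrite /B2; do 2?case: ifP.
rewrite [X in P X = _](_ : _ = [set w | forall i j, B1 i j (W i j w)]); last first.
  apply/seteqP; split=> w /=.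
    move=> [H Cw] i j; have := H i j; rewrite /B1 !mxE.
    case: ifP => // /andP[/eqP -> /eqP ->]; rewrite /ok => h.
    by rewrite asboolT.
  move=> H; have := H i0 j0; rewrite /B1 !eqxx /= /ok; case: asboolP => // h0 Cw.
  split=> // i j; have := H i j; rewrite /B1 !mxE; case: ifP => // /andP[/eqP -> /eqP ->] //.
rewrite [X in (_ = _ * P X)%E](_ : _ = [set w | forall i j, B2 i j (W i j w)]); last first.
  apply/seteqP; split=> w /= H i j; have := H i j; rewrite /B2 !mxE;
    case: ifP => // /andP[/eqP -> /eqP ->]; rewrite /ok; case: asboolP => //.
rewrite !indep // (bigD1 i0) //= (bigD1 j0) //= [in RHS](bigD1 i0) //= [in RHS](bigD1 j0) //=.
have -> : (\prod_(i < n | i != j0) P (W i0 i @^-1` B1 i0 i) =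
           \prod_(i < n | i != j0) P (W i0 i @^-1` B2 i0 i))%E.
  by apply: eq_bigr => j /negbTE jj; rewrite /B1 /B2 jj andbF.
have -> : (\prod_(i < m | i != i0) \prod_(j < n) P (W i j @^-1` B1 i j) =
           \prod_(i < m | i != i0) \prod_(j < n) P (W i j @^-1` B2 i j))%E.
  by apply: eq_bigr => i /negbTE ii; apply: eq_bigr => j _; rewrite /B1 /B2 ii.
rewrite /B1 /B2 !eqxx /=; have [_|_] := boolP ok.
  by rewrite preimage_setT probability_setT mul1e !muleA law.
by rewrite preimage_set0 measure0 !mul0e mule0.
Qed.

(** By independence the erased matrix and the erased entry have a product law. For a fixed erased
    matrix, the entry must hit the single root of a nonconstant affine function. *)
Lemma affine_entry_null (a b : mxT R m n -> R) :
  measurable_fun setT a -> measurable_fun setT b ->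
  P [set w | a (zero_entry (rand_mx W w)) != 0 /\
     a (zero_entry (rand_mx W w)) * W i0 j0 w + b (zero_entry (rand_mx W w)) = 0] = 0%E.
Proof.
move=> ma mb; have mZ := measurable_zero_rand_mx.
have mX : measurable_fun setT (W i0 j0) by exact: measurable_funP.
pose J w : mxT R m n * measurableTypeR R := (zero_entry (rand_mx W w), W i0 j0 w).
have mJ : measurable_fun setT J.
  by apply: measurable_fun_pair => //; exact: mX.
pose D : set (mxT R m n * measurableTypeR R) := [set p | a p.1 != 0 /\ a p.1 * p.2 + b p.1 = 0].
have mD : measurable D.
  have -> : D = (fun p => a p.1 != 0) @^-1` [set true] `&`
     (fun p => a p.1 * p.2 + b p.1 == 0) @^-1` [set true].
    by apply/seteqP; split=> p /= [h1 /eqP h2].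
  have ma1 : measurable_fun setT (fun p : mxT R m n * measurableTypeR R => a p.1).
    exact: (measurableT_comp ma measurable_fst).
  have mb1 : measurable_fun setT (fun p : mxT R m n * measurableTypeR R => b p.1).
    exact: (measurableT_comp mb measurable_fst).
  apply: measurableI; rewrite -[X in measurable X]setTI.
    suff mf : measurable_fun setT (fun p : mxT R m n * measurableTypeR R => a p.1 != 0) by exact: mf.
    by apply: measurable_neg; exact: measurable_fun_eqr.
  suff mf : measurable_fun setT (fun p : mxT R m n * measurableTypeR R => a p.1 * p.2 + b p.1 == 0) by exact: mf.
  apply: measurable_fun_eqr => //; apply: measurable_funD => //.
  by apply: measurable_funM => //; exact: measurable_snd.
pose Z : {mfun T >-> mxT R m n} := mfun_Sub (mem_set mZ).
pose N01 : probability (measurableTypeR R) R := normal_prob 0 1.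
have := @product_measure_unique _ _ _ _ R (distribution P Z) N01
  (measure_function_pushforward__canonical__measure_function_Measure P mJ) _ D mD.
rewrite /= /pushforward /= => <-; last by move=> A C mA mC; exact: indep_entry.
rewrite /product_measure1; apply: integral0_eq => M _ /=.
have [aM|aM] := eqVneq (a M) 0.
  rewrite (_ : xsection D M = set0) ?measure0 // -subset0 => x.
  by rewrite xsectionE /D /= aM => -[/eqP].
rewrite (_ : xsection D M = [set - b M / a M]); first exact: normal_prob_set1.
apply/seteqP; split=> x; rewrite xsectionE /D /=.
  move=> [_ /eqP]; rewrite addr_eq0 => /eqP <-.
  by rewrite mulrAC divff // mul1r.
by move=> ->; rewrite mulrCA divff // mulr1 addNr.
Qed.

End Law.

(** Cofactors along row 0 omit that row, and injectivity of [f] keeps the erased entry out of the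
    other rows. *)
Lemma cofactor_row0_zero_entry (R : realType) (m n k : nat)
    (f : 'I_k.+1 -> 'I_m) (g : 'I_k.+1 -> 'I_n) (M : 'M[R]_(m, n)) j : injective f ->
  cofactor (mxsub f g (zero_entry (f 0) (g 0) M)) 0 j = cofactor (mxsub f g M) 0 j.
Proof.
move=> finj; rewrite /cofactor; congr (_ * \det _); apply/matrixP => a b; rewrite !mxE.
by rewrite (inj_eq finj).
Qed.

(** Expanding along row 0, the minor is affine in its corner entry, with coefficients that do not
    involve this entry. The leading one is a smaller minor, almost surely nonzero by induction. *)
Lemma minor_null (R : realType) (m n : nat) (d : measure_display) (T : measurableType d)
    (P : probability T R) (W : 'I_m -> 'I_n -> {RV P >-> R}) (k : nat)
    (f : 'I_k -> 'I_m) (g : 'I_k -> 'I_n) :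
  iid_std_normal P W -> injective f -> injective g ->
  P [set w | \det (mxsub f g (rand_mx W w)) = 0] = 0%E.
Proof.
move=> iidW; elim: k f g => [|k IH] f g finj ginj.
  rewrite (_ : [set _ | _] = set0) ?measure0 // -subset0 => w /=.
  by rewrite det_mx00 => /eqP; rewrite oner_eq0.
pose a (M : mxT R m n) := cofactor (mxsub f g M) 0 0.
pose b (M : mxT R m n) :=
  \sum_(j < k) mxsub f g M 0 (lift ord0 j) * cofactor (mxsub f g M) 0 (lift ord0 j).
have mM p q : measurable_fun setT (fun M : mxT R m n => mxsub f g M p q).
  by under eq_fun do rewrite mxE; exact: measurable_entry.
have mcof j : measurable_fun setT (fun M : mxT R m n => cofactor (mxsub f g M) 0 j).
  apply: measurable_funM => //; apply: measurable_det => p q.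
  by under eq_fun do rewrite 2!mxE; exact: mM.
have ma : measurable_fun setT a by exact: mcof.
have mb : measurable_fun setT b.
  by apply: measurable_sum => j; apply: measurable_funM; [exact: mM|exact: mcof].
have aZ M : a (zero_entry (f 0) (g 0) M) = a M by exact: cofactor_row0_zero_entry.
have bZ M : b (zero_entry (f 0) (g 0) M) = b M.
  apply: eq_bigr => j _; rewrite cofactor_row0_zero_entry // !mxE.
  by rewrite eqxx (inj_eq ginj).
have detE (M : 'M[R]_(m, n)) : \det (mxsub f g M) = a M * M (f 0) (g 0) + b M.
  by rewrite (expand_det_row _ 0) big_ord_recl /a /b mulrC mxE.
have aE (M : 'M[R]_(m, n)) :
    a M = \det (mxsub (f \o lift ord0) (g \o lift ord0) M).
  rewrite /a /cofactor expr0 mul1r; congr (\det _).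
  by apply/matrixP => p q; rewrite !mxE.
have mW := measurable_rand_mx W.
have measE (h : mxT R m n -> R) : measurable_fun setT h ->
    measurable [set w | h (rand_mx W w) = 0].
  move=> mh; have mhW := measurableT_comp mh mW.
  have : measurable ((h \o rand_mx W) @^-1` [set 0]).
    by rewrite -[X in measurable X]setTI; exact: mhW.
  by [].
have mdet : measurable_fun setT (fun M : mxT R m n => \det (mxsub f g M)).
  by apply: measurable_det.
have N1 : P [set w | a (rand_mx W w) = 0] = 0%E.
  under eq_set do rewrite aE; apply: IH; apply: inj_comp => //; exact: lift_inj.
pose S := [set w | a (zero_entry (f 0) (g 0) (rand_mx W w)) != 0 /\
   a (zero_entry (f 0) (g 0) (rand_mx W w)) * W (f 0) (g 0) w
     + b (zero_entry (f 0) (g 0) (rand_mx W w)) = 0].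
have N2 : P S = 0%E by exact: affine_entry_null.
have mS : measurable S.
  rewrite (_ : S = ~` [set w | a (rand_mx W w) = 0] `&`
    [set w | \det (mxsub f g (rand_mx W w)) = 0]).
    apply: measurableI; first by apply: measurableC; exact: measE.
    exact: measE mdet.
  apply/seteqP; split=> w; rewrite /S /= aZ bZ detE mxE => -[h1 h2]; split=> //; exact/eqP.
apply/eqP; rewrite eq_le measure_ge0 andbT.
pose A0 := [set w | a (rand_mx W w) = 0].
have /le_trans : (P [set w | \det (mxsub f g (rand_mx W w)) = 0%R] <= P (A0 `|` S))%E.
  apply: le_measure; rewrite ?inE; [exact: measE mdet|by apply: measurableU => //; exact: measE|].
  move=> w /=; rewrite detE mxE => h.
  have [a0|a0] := eqVneq (a (rand_mx W w)) 0; first by left.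
  by right; rewrite /S /= aZ bZ.
have mA0 : measurable A0 by exact: measE.
have N1' : P A0 = 0%E by [].
by apply; apply: (le_trans (measureU2 _ mA0 mS)); rewrite [leLHS]/= N1' N2 adde0.
Qed.

(** * Averaging over row signs, and almost sure genericity *)

Section Averaging.
Variables (R : realType) (m n : nat) (d : measure_display) (T : measurableType d).
Variables (P : probability T R) (W : 'I_m -> 'I_n -> {RV P >-> R}).
Hypothesis iidW : iid_std_normal P W.

(* Average over the row signs, which leave the law unchanged. *)
Lemma prob_le_cnt (E : set (mxT R m n)) (K : R) : measurable E ->
  (forall M, (cnt m (fun e => E (flip e M)))%:R <= K) ->
  (P [set w | E (rand_mx W w)] <= (K / 2%:R ^+ m)%:E)%E.
Proof.
move=> mE HK.
have mA e : measurable [set w | E (flip e (rand_mx W w))].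
  have := measurableT_comp (@measurable_flip R m n e) (measurable_rand_mx W).
  by move=> /(_ measurableT _ mE); rewrite setTI.
have mE0 : measurable [set w | E (rand_mx W w)].
  by have := measurable_rand_mx W => /(_ measurableT _ mE); rewrite setTI.
(* The sum is the expected number of sign vectors putting the matrix in [E]; by [flip_law] its
   [2 ^ m] terms are equal. *)
have sumE : (\sum_(e <- signs m) P [set w | E (flip e (rand_mx W w))] <= K%:E)%E.
  have -> : (\sum_(e <- signs m) P [set w | E (flip e (rand_mx W w))] =
      \int[P]_w (\sum_(e <- signs m) (\1_[set w | E (flip e (rand_mx W w))] w)%:E))%E.
    rewrite ge0_integral_sum //.
    - by apply: eq_bigr => e _; rewrite integral_indic // setIT.
    - by move=> e; apply/measurable_EFinP; exact: measurable_indic.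
  have -> : K%:E = (\int[P]_w (cst K%:E w))%E.
    by rewrite integral_cst //= probability_setT mule1.
  apply: ge0_le_integral => //.
  - by move=> w _; rewrite sume_ge0.
  - by apply: emeasurable_sum => e; apply/measurable_EFinP; exact: measurable_indic.
  - move=> w _; rewrite sumEFin lee_fin; apply: le_trans (HK (rand_mx W w)).
    rewrite /cnt natr_sum; apply: ler_sum => e _.
    rewrite indicE ler_nat; case: asboolP => [_|h]; first exact: leq_b1.
    by rewrite memNset.
rewrite -(@fineK _ (P _)) ?fin_num_measure // lee_fin ler_pdivlMr ?exprn_gt0 ?ltr0n //.
rewrite -lee_fin; apply: le_trans sumE.
rewrite (eq_bigr (fun=> (fine (P [set w | E (rand_mx W w)]))%:E)); last first.
  by move=> e _; rewrite fineK ?fin_num_measure //; exact: flip_law.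
rewrite sumEFin lee_fin big_const_seq count_predT size_signs iter_addr_0.
by rewrite -[leRHS]mulr_natr natrX.
Qed.

(** Genericity as finitely many polynomial conditions, which makes it measurable. *)
Definition generic_det : set (mxT R m n) :=
  [set M | forall f : {ffun 'I_n -> 'I_m}, injectiveb f -> \det (rowsub f M) != 0].

Lemma generic_det_generic M : generic_det M -> generic M.
Proof.
move=> gM f finj y fy.
have ff : injectiveb (finfun f) by apply/injectiveP => k l; rewrite !ffunE => /finj.
have uA : rowsub (finfun f) M \in unitmx by rewrite unitmxE unitfE gM.
apply: (can_inj (mulKmx uA)); rewrite mulmx0; apply/matrixP => k j; rewrite !ord1.
transitivity ((M *m y) (f k) 0); last by rewrite fy mxE.
by rewrite !mxE; apply: eq_bigr => l _; rewrite mxE ffunE.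
Qed.

Lemma measurable_generic_det : measurable generic_det.
Proof.
have -> : generic_det = \bigcap_(f in [set f : {ffun 'I_n -> 'I_m} | injectiveb f])
    ((fun M : mxT R m n => \det (rowsub f M)) @^-1` (~` [set 0])).
  apply/seteqP; split=> [M gM f fi /eqP|M gM f fi]; first by rewrite (negbTE (gM f fi)).
  by apply/eqP; exact: gM.
apply: fin_bigcap_measurable; first exact: finite_finset.
move=> f _; rewrite -[X in measurable X]setTI; apply: measurable_det => //.
  by move=> i j; under eq_fun do rewrite mxE; exact: measurable_entry.
exact: measurableC.
Qed.

Lemma generic_det_as : P [set w | ~ generic_det (rand_mx W w)] = 0%E.
Proof.
pose S (f : {ffun 'I_n -> 'I_m}) :=
  if injectiveb f then [set w | \det (rowsub f (rand_mx W w)) = 0] else set0.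
have -> : [set w | ~ generic_det (rand_mx W w)] =
    \big[setU/set0]_(f <- enum {ffun 'I_n -> 'I_m}) S f.
  rewrite -bigcup_seq; apply/seteqP; split=> w /=.
    move=> /existsNP[f /not_implyP[fi /negP/negPn/eqP h]].
    by exists f; rewrite /= ?mem_enum // /S fi.
  move=> [f _]; rewrite /S; case: ifP => // fi h gW.
  by have := gW f fi; rewrite h eqxx.
suff [] : measurable (\big[setU/set0]_(f <- enum {ffun 'I_n -> 'I_m}) S f) /\
  P (\big[setU/set0]_(f <- enum {ffun 'I_n -> 'I_m}) S f) = 0%E by [].
elim/big_ind: _ => [|A B [mA A0] [mB B0]|f _].
- by rewrite measure0.
- split; first exact: measurableU.
  apply/eqP; rewrite eq_le measure_ge0 andbT (le_trans (measureU2 _ mA mB)) //=.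
  by rewrite A0 B0 adde0.
- rewrite /S; case: ifP => [/injectiveP fi|_]; last by rewrite measure0.
  split; last exact: minor_null.
  have mf : measurable_fun setT (fun M : mxT R m n => \det (rowsub f M)).
    apply: measurable_det => i j; under eq_fun do rewrite mxE; exact: measurable_entry.
  have := measurableT_comp mf (measurable_rand_mx W).
  by move=> /(_ measurableT [set 0] (measurable_set1 _)); rewrite setTI.
Qed.

Lemma measurable_rand_mx_event (E : set (mxT R m n)) : measurable E ->
  measurable [set w | E (rand_mx W w)].
Proof.
by move=> mE; have := measurable_rand_mx W => /(_ measurableT _ mE); rewrite setTI.
Qed.

Lemma prob_le_generic (E : set (mxT R m n)) : measurable E ->
  (P [set w | E (rand_mx W w)] <=
   P [set w | (E `&` generic_det) (rand_mx W w)])%E.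
Proof.
move=> mE; have mG := measurable_generic_det.
have m1 := measurable_rand_mx_event mE.
have m2 := measurable_rand_mx_event (measurableI _ _ mE mG).
have m3 := measurable_rand_mx_event (measurableC mG).
have := generic_det_as; rewrite -[X in P X]/[set w | (~` generic_det) (rand_mx W w)] => N0.
apply: (@le_trans _ _ (P ([set w | (E `&` generic_det) (rand_mx W w)] `|`
   [set w | (~` generic_det) (rand_mx W w)]))).
  apply: le_measure; rewrite ?inE //; first exact: measurableU.
  move=> w /= Ew; have [g|g] := pselect (generic_det (rand_mx W w)); [by left|by right].
apply: (le_trans (measureU2 _ m2 m3)).
by rewrite -[leRHS]adde0; apply: leeD => //; rewrite /= N0.
Qed.

End Averaging.

(** * Probability bounds and limits *)

Section NotInjectiveMeasurable.
Variables (R : realType) (m n : nat).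
Implicit Types (M : 'M[R]_(m, n)) (J : {set 'I_m}).

Definition keep_rows J M : 'M[R]_(m, n) := \matrix_(i, j) if i \in J then M i j else 0.

Lemma keep_rowsE J M (v : 'cV[R]_n) i :
  (keep_rows J M *m v) i 0 = if i \in J then (M *m v) i 0 else 0.
Proof.
case: ifP => iJ; rewrite !mxE.
  by apply: eq_bigr => j _; rewrite mxE iJ.
by rewrite big1 // => j _; rewrite mxE iJ mul0r.
Qed.

(** Turns the existence of a kernel vector into a polynomial equation: if the Gram matrix of [Z]
    kills [v], then the squared norm of [Z v] is 0. *)
Lemma gram_det_eq0 J M :
  (exists2 v : 'cV[R]_n, v != 0 & {in J, forall i, (M *m v) i 0 = 0}) <->
  \det ((keep_rows J M)^T *m keep_rows J M) = 0.
Proof.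
set Z := keep_rows J M; split=> [[v v0 vJ]|/eqP/det0P[v v0 vZ]].
  have Zv : Z *m v = 0.
    apply/matrixP => i j; rewrite !ord1 keep_rowsE [RHS]mxE.
    by case: ifP => // iJ; exact: vJ.
  apply/eqP/det0P; exists v^T; first by rewrite trmx_eq0.
  by rewrite mulmxA -trmx_mul Zv trmx0 mul0mx.
exists v^T; first by rewrite trmx_eq0.
have : \sum_i (Z *m v^T) i 0 ^+ 2 = 0.
  have : (v *m Z^T *m (Z *m v^T)) 0 0 = 0 by rewrite !mulmxA -(mulmxA v) vZ mul0mx mxE.
  rewrite mxE => E; rewrite -[RHS]E; apply: eq_bigr => i _.
  by rewrite -[v *m Z^T]trmxK trmx_mul trmxK [in RHS]mxE expr2.
move=> /eqP; rewrite psumr_eq0 => [/allP H i iJ|i _]; last exact: sqr_ge0.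
have := H i (mem_index_enum _); rewrite /= sqrf_eq0 keep_rowsE iJ => /eqP.
by [].
Qed.

(** Strict inequalities survive small moves, so the coordinates are made rational one after another.
    This reduces a union over real vectors to a countable one. *)
Lemma rational_negative J M (z : 'cV[R]_n) :
  (forall i, i \notin J -> (M *m z) i 0 < 0) ->
  exists q : 'cV[rat]_n, forall i, i \notin J -> (M *m map_mx ratr q) i 0 < 0.
Proof.
move=> zJ.
have flin i (x : 'cV_n) t u : (M *m (x + t *: u)) i 0 = (M *m x) i 0 + t * (M *m u) i 0.
  by rewrite mulmxDr -scalemxAr !mxE.
have [x [xq xJ]] : exists x : 'cV[R]_n,
    {in enum 'I_n, forall j, exists q : rat, x j 0 = ratr q} /\
    forall i, i \notin J -> (M *m x) i 0 < 0.
  elim: (enum 'I_n) => [|j l [x [xl xJ]]]; first by exists z.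
  have [t t_gt0 Ht] := perturb flin (enum 'I_m) x (delta_mx j 0).
  have [q /andP[q1 q2]] : exists q, ratr q \in `]x j 0, (x j 0 + t)[.
    by apply: rat_in_itvoo; rewrite ltrDl.
  rewrite /= !bnd_simp in q1 q2.
  exists (x + (ratr q - x j 0) *: delta_mx j 0); split.
    move=> k; rewrite inE !mxE; have [-> _|kj /= kl] := eqVneq k j.
      by exists q; rewrite eqxx mulr1 addrC subrK.
    have [p xp] := xl k kl; exists p.
    by rewrite /= mulr0 addr0.
  move=> i iJ; rewrite -sgr_lt0 Ht ?mem_enum // ?sgr_lt0 ?xJ // ?lt_eqF ?xJ //.
  rewrite gtr0_norm; lra.
have /choice[q Hq] : forall j, exists q : rat, x j 0 = ratr q.
  by move=> j; apply: xq; rewrite mem_enum.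
exists (\col_j q j); suff -> : map_mx ratr (\col_j q j) = x by [].
by apply/matrixP => j k; rewrite !ord1 !mxE Hq.
Qed.

(* A measure takes arbitrary values on non-measurable sets, so the event has to be
   measurable everywhere and not only up to a null set. *)
Lemma measurable_not_injective :
  measurable ([set M | ~ relu_injective M] : set (mxT R m n)).
Proof.
have -> : ([set M | ~ relu_injective M] : set (mxT R m n)) =
  \bigcup_(J : {set 'I_m})
    ((fun M : mxT R m n => \det ((keep_rows J M)^T *m keep_rows J M)) @^-1` [set 0] `&`
     \bigcup_(q : 'cV[rat]_n) \bigcap_(i in [set i | i \notin J])
       ((fun M : mxT R m n => (M *m map_mx ratr q) i 0) @^-1` `]-oo, 0[)).
  apply/seteqP; split=> M /=.
    move=> /not_relu_injectiveP[J [/gram_det_eq0 h [z /rational_negative[q hq]]]].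
    exists J => //; split=> //; by exists q.
  move=> [J _ [/gram_det_eq0 h [q _ hq]]]; apply/not_relu_injectiveP.
  exists J; split=> //; exists (map_mx ratr q) => i iJ.
  by have := hq i iJ; rewrite set_itvE.
apply: fin_bigcup_measurable; first exact: finite_finset.
move=> J _; apply: measurableI.
  rewrite -[X in measurable X]setTI; apply: measurable_det => //.
  have mk i j : measurable_fun setT (fun M : mxT R m n => keep_rows J M i j).
    under eq_fun do rewrite mxE.
    by case: (i \in J); [exact: measurable_entry|exact: measurable_cst].
  apply: measurable_mul_entry => // i j.
  by under eq_fun do rewrite mxE; exact: mk.
apply: countable_bigcupT_measurable; first exact: countableP.
move=> q; apply: fin_bigcap_measurable; first exact: finite_finset.
move=> i _; rewrite -[X in measurable X]setTI.
by apply: measurable_mul_entry => // a b; exact: measurable_entry.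
Qed.

End NotInjectiveMeasurable.

Section Bounds.
Variables (R : realType) (m n : nat) (d : measure_display) (T : measurableType d).
Variables (P : probability T R) (W : 'I_m -> 'I_n -> {RV P >-> R}).
Hypothesis iidW : iid_std_normal P W.

Lemma prob_not_injective_le : (0 < n <= m)%N ->
  (P [set w | ~ relu_injective (rand_mx W w)] <=
   (((11%:R / 10%:R) ^+ m * 10%:R ^+ n) ^+ 2 / 2%:R ^+ m)%:E)%E.
Proof.
move=> nm; have mN := @measurable_not_injective R m n.
apply: (le_trans (prob_le_generic iidW mN)).
apply: (prob_le_cnt iidW (measurableI _ _ mN (@measurable_generic_det R m n))) => M.
apply: le_trans (cnt_few_positive M); rewrite ler_nat; apply: leq_cnt => e _ [/= ni g].
by apply: generic_few_positive => //; exact: generic_det_generic.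
Qed.

Lemma prob_injective_le : (n <= m)%N ->
  (inj_prob P W <= (fail_bound R (m - m./2) m./2 n n / 2%:R ^+ m)%:E)%E.
Proof.
move=> nm; have := measurableC (@measurable_not_injective R m n).
rewrite (_ : ~` _ = [set M : mxT R m n | relu_injective M]); last first.
  by apply/seteqP; split=> M /=; [move/contrapT|move=> ? []].
move=> mI; apply: (le_trans (prob_le_generic iidW mI)).
apply: (prob_le_cnt iidW (measurableI _ _ mI (@measurable_generic_det R m n))) => M.
have [g|g] := pselect (generic M).
  apply: le_trans (cnt_not_few_positive nm g); rewrite ler_nat; apply: leq_cnt => e _ [/= ni _].
  by move/few_positive_not_injective; apply.
rewrite (_ : cnt _ _ = 0%N).
  by apply: addr_ge0; rewrite !mulr_ge0 // exprn_ge0 //; lra.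
(* For a matrix that is not generic, no row flip is generic either, so nothing is counted. *)
rewrite /cnt big1 // => e _; rewrite asboolF // => -[_ /generic_det_generic].
by move/generic_flip.
Qed.

End Bounds.

(** * Exponential rates and the limits; powers [q] clear the denominators of the thresholds 21/2 and
    33/10 *)

Lemma cvg0_pow_le_geometric (R : realType) (b : nat -> R) (n : nat -> nat) (C rho : R) (q : nat) :
  0 <= rho < 1 -> (0 < q)%N -> (forall k, 0 <= b k) ->
  (forall k, b k ^+ q <= C * rho ^+ n k) ->
  (forall N : nat, exists K : nat, forall k, (K <= k)%N -> (N <= n k)%N) ->
  b @ \oo --> (0 : R).
Proof.
move=> /andP[r0 r1] q0 b0 bq noo; apply/cvgrPdist_lt => eps eps0.
have : (fun k => C * rho ^+ k) @ \oo --> (C * 0 : R).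
  by apply: cvgMr; apply: cvg_expr; rewrite ger0_norm.
rewrite mulr0 => /cvgrPdist_lt /(_ (eps ^+ q) (exprn_gt0 _ eps0))[N _ HN].
have [K HK] := noo N; exists K => // k /= Kk.
rewrite sub0r normrN ger0_norm //.
rewrite -(ltr_pXn2r q0) ?nnegrE ?b0 //; last exact: ltW.
apply: (le_lt_trans (bq k)).
have := HN (n k) (HK k Kk); rewrite /= sub0r normrN.
exact: le_lt_trans (ler_norm _).
Qed.

Lemma upper_rate_lt1 (R : realType) :
  0 <= (121%:R / 200%:R : R) ^+ 21 * 10%:R ^+ 4 < 1.
Proof.
have a0 : 0 <= (121%:R / 200%:R : R) by lra.
(* The grouping reduces the claim to (121/200)^5 * 10 <= 1. *)
have -> : (121%:R / 200%:R) ^+ 21 * 10%:R ^+ 4 =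
   ((121%:R / 200%:R) ^+ 5 * 10%:R) ^+ 4 * (121%:R / 200%:R) :> R.
  by move: (121%:R / 200%:R) => x; ring.
rewrite mulr_ge0 ?exprn_ge0 ?mulr_ge0 ?exprn_ge0 //=.
apply: (@le_lt_trans _ _ (121%:R / 200%:R)); last lra.
rewrite ler_piMl // exprn_ile1 ?mulr_ge0 ?exprn_ge0 //; lra.
Qed.

Lemma lower_rate_lt1 (R : realType) :
  0 <= (5%:R / 4%:R : R) ^+ 33 * (2%:R / 3%:R) ^+ 20 < 1.
Proof.
have a0 : 0 <= (5%:R / 4%:R : R) by lra.
have b0 : 0 <= (2%:R / 3%:R : R) by lra.
(* Here 33 = 5 * 6 + 3 and 20 = 3 * 6 + 2, and both grouped factors are below 1. *)
have -> : (5%:R / 4%:R) ^+ 33 * (2%:R / 3%:R) ^+ 20 =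
   ((5%:R / 4%:R) ^+ 5 * (2%:R / 3%:R) ^+ 3) ^+ 6 * ((5%:R / 4%:R) ^+ 3 * (2%:R / 3%:R) ^+ 2) :> R.
  by move: (5%:R / 4%:R) (2%:R / 3%:R) => x y; ring.
rewrite !mulr_ge0 ?exprn_ge0 ?mulr_ge0 ?exprn_ge0 //=.
apply: (@le_lt_trans _ _ ((5%:R / 4%:R) ^+ 3 * (2%:R / 3%:R) ^+ 2)); last lra.
rewrite ler_piMl ?mulr_ge0 ?exprn_ge0 // exprn_ile1 ?mulr_ge0 ?exprn_ge0 //; lra.
Qed.

(** With 121/200 = (11/10)^2 / 2 the square is (121/200)^(2m) * 10^(4n), and the base is below 1, so
    2m may be lowered to 21n. *)
Lemma upper_bound_pow (R : realType) (m n : nat) : (21 * n <= 2 * m)%N ->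
  (((11%:R / 10%:R) ^+ m * 10%:R ^+ n) ^+ 2 / 2%:R ^+ m) ^+ 2 <=
    1 * ((121%:R / 200%:R) ^+ 21 * 10%:R ^+ 4) ^+ n :> R.
Proof.
move=> nm; have a0 : 0 <= (121%:R / 200%:R : R) by lra.
have -> : (((11%:R / 10%:R) ^+ m * 10%:R ^+ n) ^+ 2 / 2%:R ^+ m) ^+ 2 =
   (121%:R / 200%:R) ^+ (2 * m) * (10%:R ^+ 4) ^+ n :> R.
  rewrite (_ : 121%:R / 200%:R = (11%:R / 10%:R) ^+ 2 / 2%:R :> R); last by field.
  move: (10%:R : R) (2%:R : R) (11%:R / 10%:R : R) => y z a.
  have -> : (a ^+ 2 / z) ^+ (2 * m) = ((a ^+ m) ^+ 2 / z ^+ m) ^+ 2.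
    by rewrite mulnC exprM exprMn exprVn exprAC.
  rewrite [(y ^+ 4) ^+ n]exprAC; move: (a ^+ m) (y ^+ n) ((z ^+ m)^-1) => u v t.
  by ring.
have a1 : (121%:R / 200%:R : R) <= 1 by lra.
move: (121%:R / 200%:R : R) a0 a1 => x x0 x1.
rewrite mul1r [(x ^+ 21 * _) ^+ n]exprMn -[(x ^+ 21) ^+ n]exprM ler_wpM2r ?exprn_ge0 //.
exact: ler_wiXn2l.
Qed.

(** Since [m - m./2] may exceed m/2 by one half, its 20-fold is at most 10m + 10 <= 33n + 10; this
    is the origin of the factor (5/4)^10. *)
Lemma lower_bound_pow (R : realType) (m n : nat) : (10 * m <= 33 * n)%N ->
  (2%:R * ((5%:R / 4%:R) ^+ (m - m./2) * (2%:R / 3%:R) ^+ n)) ^+ 20 <=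
    2%:R ^+ 20 * (5%:R / 4%:R) ^+ 10 *
    ((5%:R / 4%:R) ^+ 33 * (2%:R / 3%:R) ^+ 20) ^+ n :> R.
Proof.
move=> mn; have x1 : 1 <= (5%:R / 4%:R : R) by lra.
have y0 : 0 <= (2%:R / 3%:R : R) by lra.
move: (5%:R / 4%:R : R) (2%:R / 3%:R : R) x1 y0 => x y x1 y0.
rewrite exprMn -[leRHS]mulrA ler_wpM2l ?exprn_ge0 ?ler0n //.
rewrite [(_ * y ^+ n) ^+ 20]exprMn [(_ * y ^+ 20) ^+ n]exprMn -!exprM mulrA -exprD [(20 * n)%N]mulnC.
rewrite ler_wpM2r ?exprn_ge0 //.
by apply: ler_weXn2l => //; lia.
Qed.

(** Dividing by [2 ^ m] cancels the doublings and turns 5/2 into 5/4; both halves have at most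
    [m - m./2] rows. *)
Lemma fail_bound_le (R : realType) (m n : nat) :
  fail_bound R (m - m./2) m./2 n n / 2%:R ^+ m <=
    2%:R * ((5%:R / 4%:R) ^+ (m - m./2) * (2%:R / 3%:R) ^+ n).
Proof.
have sm : m = (m - m./2 + m./2)%N by lia.
have key (p q r : nat) : m = (p + q)%N -> (p <= r)%N ->
    2%:R ^+ q * (5%:R / 2%:R) ^+ p * (2%:R / 3%:R) ^+ n / 2%:R ^+ m <=
    (5%:R / 4%:R) ^+ r * (2%:R / 3%:R) ^+ n :> R.
  move=> -> pr; have -> : 2%:R ^+ q * (5%:R / 2%:R) ^+ p * (2%:R / 3%:R) ^+ n / 2%:R ^+ (p + q) =
      (5%:R / 4%:R) ^+ p * (2%:R / 3%:R) ^+ n :> R.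
    rewrite (_ : 5%:R / 4%:R = 5%:R / 2%:R / 2%:R :> R); last by field.
    rewrite [(5%:R / 2%:R / 2%:R) ^+ p]expr_div_n exprD.
    by field; rewrite !expf_neq0 //; lra.
  apply: ler_wpM2r; first by rewrite exprn_ge0 //; lra.
  by apply: ler_weXn2l => //; lra.
set X := _ ^+ _ * _ ^+ n; have -> : 2%:R * X = X + X by ring.
by rewrite /fail_bound mulrDl lerD //; apply: key => //; lia.
Qed.

Theorem theorem2 (R : realType) (c : R) (m n : nat -> nat)
  (d : nat -> measure_display) (T : forall k, measurableType (d k))
  (P : forall k, probability (T k) R)
  (W : forall k, 'I_(m k) -> 'I_(n k) -> {RV P k >-> R}) :
  (forall k, (0 < m k)%N /\ (0 < n k)%N) ->
  (forall k, (m k)%:R = c * (n k)%:R) ->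
  (forall N : nat, exists K : nat, forall k, (K <= k)%N -> (N <= n k)%N) ->
  (forall k, iid_std_normal (P k) (W k)) ->
  ((21%:R / 2%:R <= c ->
      (fun k => inj_prob (P k) (W k)) @ \oo --> (1%:E : \bar R)) /\
   (c <= 33%:R / 10%:R ->
      (fun k => inj_prob (P k) (W k)) @ \oo --> (0%:E : \bar R))).
Proof.
move=> pos mcn noo iidW; split=> hc.
- have nm k : (21 * n k <= 2 * m k)%N.
    by rewrite -(ler_nat R) !natrM mcn; have : 0 <= (n k)%:R :> R by []; nra.
  pose b k : R := ((11%:R / 10%:R) ^+ m k * 10%:R ^+ n k) ^+ 2 / 2%:R ^+ m k.
  have b0 k : 0 <= b k by rewrite divr_ge0 ?exprn_ge0 ?mulr_ge0 ?exprn_ge0 //; lra.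
  have bcvg : b @ \oo --> (0 : R).
    apply: (cvg0_pow_le_geometric (upper_rate_lt1 R) (isT : 0 < 2)%N b0 _ noo) => k.
    exact: upper_bound_pow.
  have mI k : measurable [set w | ~ relu_injective (rand_mx (W k) w)].
    exact: measurable_rand_mx_event (@measurable_not_injective R _ _).
  have injE k : inj_prob (P k) (W k) =
      (1 - P k [set w | ~ relu_injective (rand_mx (W k) w)])%E.
    rewrite -probability_setC //; congr (P k _).
    by apply/seteqP; split=> w /=; [move=> h /(_ h)|move/contrapT].
  apply: (@squeeze_cvge _ _ _ _ (fun k => (1 - b k)%:E) _ (cst 1%:E)).
  + apply: nearW => k; rewrite injE; apply/andP; split.
      rewrite EFinB leeB //; apply: prob_not_injective_le => //.
      by have [_ ->] := pos k; have := nm k; lia.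
    by rewrite -[leRHS]sube0 leeB.
  + apply: cvg_EFin; first exact: nearW.
    by rewrite -[X in _ --> X]subr0; apply: cvgB => //; exact: cvg_cst.
  + exact: cvg_cst.
- have nm k : (10 * m k <= 33 * n k)%N.
    by rewrite -(ler_nat R) !natrM mcn; have : 0 <= (n k)%:R :> R by []; nra.
  pose b k : R := 2%:R * ((5%:R / 4%:R) ^+ (m k - (m k)./2) * (2%:R / 3%:R) ^+ n k).
  have b0 k : 0 <= b k by rewrite !mulr_ge0 ?exprn_ge0 //; lra.
  have bcvg : b @ \oo --> (0 : R).
    apply: (cvg0_pow_le_geometric (lower_rate_lt1 R) (isT : 0 < 20)%N b0 _ noo) => k.
    exact: lower_bound_pow.
  apply: (@squeeze_cvge _ _ _ _ (cst 0%:E) _ (fun k => (b k)%:E)).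
  + apply: nearW => k; apply/andP; split; first exact: measure_ge0.
    (* Small [c] allows [m k < n k], where the layer is never injective and the counting bound does
       not apply. *)
    have [mn|mn] := ltnP (m k) (n k).
      rewrite /inj_prob (_ : [set _ | _] = set0) ?measure0 ?lee_fin // -subset0 => w /=.
      exact: not_relu_injective_wide.
    apply: (le_trans (prob_injective_le (iidW k) mn)).
    by rewrite lee_fin fail_bound_le.
  + exact: cvg_cst.
  + by apply: cvg_EFin => //; exact: nearW.
Qed.
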